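(* Every GaTEx graph is a permutation graph.
   Context: All graphs are finite, simple and undirected. A galled-tree on a finite nonempty set $X$ is a directed acyclic graph $N=(V,E)$ such that either $V=X=\{x\}$ and $E=\emptyset$, or: (N1) there is a unique root with indegree 0 and outdegree at least 2; (N2) $x\in X$ iff $x$ has outdegree 0 and indegree 1; (N3) every non-root $v\in V\setminus X$ has either indegree 1 and outdegree at least 2, or indegree 2 and outdegree at least 1 (hybrid-vertex); (N4) each biconnected component $C$ of $N$ contains at most one hybrid-vertex whose two in-neighbours both belong to $C$. For $x,y\in X$, $\mathrm{lca}_N(x,y)$ is the (unique) minimal common ancestor of $x,y$. A labeled galled-tree $(N,t)$ has $t:V\to\{0,1,\odot\}$ with $t(x)=\odot$ iff $x\in X$; it explains the graph on $X$ where $\{x,y\}$ is an edge iff $t(\mathrm{lca}_N(x,y))=1$. A graph is GaTEx if it is isomorphic to a graph explained by some labeled galled-tree. A graph $G=(V,E)$ with $|V|=n$ is a permutation graph if there are a bijection $\ell:V\to\{1,\dots,n\}$ and a permutation $\pi$ of $\{1,\dots,n\}$ such that for distinct $u,v\in V$, $\{u,v\}\in E$ iff $\ell(u)>\ell(v)$ and $\pi^{-1}(\ell(u))<\pi^{-1}(\ell(v))$, or vice versa with $u,v$ interchanged. *)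

(* Defs.v *)
From mathcomp Require Import all_boot all_fingroup.

Set Implicit Arguments.
Unset Strict Implicit.
Unset Printing Implicit Defensive.

Section Digraph.
Variables (V : finType) (e : rel V).

Definition indeg (v : V) : nat := #|[set w | e w v]|.
Definition outdeg (v : V) : nat := #|[set w | e v w]|.

(* Reachability is reflexive, so this also excludes loops. *)
Definition acyclic : Prop := forall u v, e u v -> ~~ connect e v u.

Definition underlying : rel V := [rel u v | e u v || e v u].

Definition connected_in (C : {set V}) : bool :=
  [forall x in C, forall y in C,
     connect [rel u v | [&& u \in C, v \in C & underlying u v]] x y].

(* Single vertices and single edges count as biconnected. *)
Definition biconnected (C : {set V}) : bool :=
  [&& C != set0, connected_in C & [forall v in C, connected_in (C :\ v)]].

(* Maximal biconnected subgraphs are induced, so they are given by their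
   vertex sets. *)
Definition biconnected_component (C : {set V}) : bool := maxset biconnected C.

Definition hybrid (v : V) : bool := (indeg v == 2) && (1 <= outdeg v).

Definition hybrid_of (C : {set V}) (h : V) : bool :=
  [&& hybrid h, h \in C & [set w | e w h] \subset C].

Definition galled_tree (X : {set V}) : Prop :=
  [/\ X != set0, acyclic &
   (exists x, [/\ X = [set x], [set: V] = [set x] & forall u v, ~~ e u v])
   \/
   (exists r,
     [/\ [/\ indeg r = 0, 2 <= outdeg r & forall v, indeg v = 0 -> v = r],
         forall x, x \in X <-> outdeg x = 0 /\ indeg x = 1,
         forall v, v != r -> v \notin X ->
           (indeg v = 1 /\ 2 <= outdeg v) \/ hybrid v
       & forall C, biconnected_component C ->
           forall h1 h2, hybrid_of C h1 -> hybrid_of C h2 -> h1 = h2])].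

Definition common_ancestor (x y v : V) : bool := connect e v x && connect e v y.

Definition min_common_ancestor (x y v : V) : bool :=
  common_ancestor x y v &&
  [forall w, common_ancestor x y w ==> connect e v w ==> (w == v)].

(* In a galled-tree any two leaves have exactly one minimal common ancestor;
   [pick] then returns it. *)
Definition lca (x y : V) : option V := [pick v | min_common_ancestor x y v].

End Digraph.

Variant label := Lab0 | Lab1 | LabLeaf.

Definition labeling (V : finType) (X : {set V}) (t : V -> label) : Prop :=
  forall v, t v = LabLeaf <-> v \in X.

Definition explained (V : finType) (e : rel V) (X : {set V}) (t : V -> label) :
    rel {x : V | x \in X} :=
  fun x y => (x != y) &&
    (if omap t (lca e (val x) (val y)) is Some Lab1 then true else false).

Definition simple_graph (T : finType) (adj : rel T) : Prop :=
  symmetric adj /\ irreflexive adj.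

Definition isomorphic (T U : finType) (a : rel T) (b : rel U) : Prop :=
  exists2 f : T -> U, bijective f & forall x y, a x y = b (f x) (f y).

Definition GaTEx (T : finType) (adj : rel T) : Prop :=
  exists (V : finType) (e : rel V) (X : {set V}) (t : V -> label),
    [/\ galled_tree e X, labeling X t & isomorphic adj (@explained V e X t)].

(* 'I_n is {0, ..., n-1}; only the order of the values matters. *)
Definition permutation_graph (T : finType) (adj : rel T) : Prop :=
  exists (l : T -> 'I_#|T|) (p : 'S_#|T|), bijective l /\
    forall u v, u != v ->
      (adj u v <->
        (l v < l u /\ (p^-1)%g (l u) < (p^-1)%g (l v)) \/
        (l u < l v /\ (p^-1)%g (l v) < (p^-1)%g (l u))).

(* Main.v *)
Require Import Defs.
From mathcomp Require Import all_boot all_fingroup.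

(** A graph is a permutation graph as soon as it and its complement have
transitive orientations [o] and [o']: the two linear orders are the union of
[o] and [o'] and the union of the reverse of [o] and [o'].  Exchanging the
labels 0 and 1 complements the explained graph, so it suffices to orient the
graph explained by any labeled galled-tree transitively.

This is done by induction on the descendants of a vertex [v].  By (N4), if two
children [c], [c'] of [v] have common descendants, these are exactly the
descendants of one hybrid-vertex [h], no third child meets [c] or [c'], and on
either side of this cycle the leaves hanging off at a vertex see all leaves
further down through the same lca.  Hence any transitive orientation of the
leaves below [h] extends to those below [c], with all arcs directed towards the
leaves below [h], and likewise for [c'].  As the two sides see each other
through [v], they are glued along [h] with all arcs pointing towards [h] if [v]
has label 0, and, after reversing one side, with all arcs running from the first
side through [h] to the second if [v] has label 1. *)

Set Implicit Arguments.
Unset Strict Implicit.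
Unset Printing Implicit Defensive.

Lemma path_connect_last (V : finType) (e : rel V) x p z :
  path e x p -> z \in x :: p -> connect e z (last x p).
Proof.
move=> xp zp; case/splitPl: p / zp xp => p1 p2 zE; rewrite cat_path => /andP[_].
by rewrite last_cat zE => zp2; apply/connectP; exists p2.
Qed.

(** * Biconnected vertex sets *)

Section Biconnected.
Variables (V : finType) (e : rel V).
Implicit Types (C D : {set V}) (p : seq V).

Lemma connected_inP C :
  reflect {in C &, forall x y,
    connect [rel u v | [&& u \in C, v \in C & underlying e u v]] x y}
          (connected_in e C).
Proof.
apply: (iffP forall_inP) => [cC x y xC yC | cC x xC].
  by have /forall_inP := cC x xC; apply.
by apply/forall_inP=> y yC; apply: cC.
Qed.

Lemma connected_inU C D z :
  connected_in e C -> connected_in e D -> z \in C -> z \in D ->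
  connected_in e (C :|: D).
Proof.
move=> /connected_inP cC /connected_inP cD zC zD.
set E := C :|: D; apply/connected_inP.
pose rE := [rel u v | [&& u \in E, v \in E & underlying e u v]].
have sub (F : {set V}) : F \subset E ->
    subrel (connect [rel u v | [&& u \in F, v \in F & underlying e u v]])
           (connect rE).
  move=> /subsetP sFE; apply: connect_sub => u v /and3P[uF vF uv].
  by apply: connect1; rewrite /= !sFE.
have toz x : x \in E -> connect rE x z /\ connect rE z x.
  case/setUP=> xE; split; solve
    [ by apply: (sub C (subsetUl _ _)); apply: cC
    | by apply: (sub D (subsetUr _ _)); apply: cD ].
move=> x y /toz[xz _] /toz[_ zy]; exact: connect_trans xz zy.
Qed.

Lemma connected_in_path x p :
  path (underlying e) x p -> connected_in e [set z in x :: p].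
Proof.
elim: p x => [|y p IHp] x /=.
  move=> _; apply/connected_inP => u v; rewrite !inE => /eqP-> /eqP->.
  exact: connect0.
move=> /andP[xy /IHp cp].
have -> : [set z in [:: x, y & p]] = [set x; y] :|: [set z in y :: p].
  apply/setP=> z; rewrite !inE.
  by case: (z == x); case: (z == y); rewrite ?orbT.
apply: (@connected_inU _ _ y) => //; last 2 first.
- by rewrite !inE eqxx orbT.
- by rewrite !inE eqxx.
apply/connected_inP=> u v; rewrite !inE.
move=> /orP[]/eqP-> /orP[]/eqP->; rewrite ?connect0 //; apply: connect1 => /=;
  rewrite !inE !eqxx ?orbT //=.
by move: xy; rewrite /underlying /= orbC.
Qed.

(** Rotating the cycle brings the deleted vertex to the front, and what remains is a path. *)
Lemma cycle_biconnected x p :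
  path (underlying e) x p -> underlying e (last x p) x -> uniq (x :: p) ->
  biconnected e [set z in x :: p].
Proof.
move=> xp lx Up; apply/and3P; split.
- by apply/set0Pn; exists x; rewrite !inE eqxx.
- exact: connected_in_path.
apply/forall_inP => v; rewrite inE => vp.
have [i q Dq] := rot_to vp.
have cyc : path.cycle (underlying e) (v :: q).
  by rewrite -Dq rot_cycle /= rcons_path xp.
have Uq : uniq (v :: q) by rewrite -Dq rot_uniq.
have -> : [set z in x :: p] :\ v = [set z in q].
  apply/setP=> z; have := mem_rot i (x :: p) z; rewrite Dq !inE => <-.
  case: eqP => //= ->; case/andP: Uq => /negbTE-> //.
case: q cyc {Dq Uq} => [|y q] /=.
  by move=> _; apply/connected_inP => u w; rewrite inE.
rewrite rcons_path => /andP[_ /andP[yq _]].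
exact: connected_in_path.
Qed.

(** Any deleted vertex spares [a] or [b], and the two remainders stay connected through the spared
    one. *)
Lemma biconnectedU C D a b :
  biconnected e C -> biconnected e D -> a != b ->
  a \in C -> b \in C -> a \in D -> b \in D -> biconnected e (C :|: D).
Proof.
move=> /and3P[C0 cC /forall_inP dC] /and3P[_ cD /forall_inP dD] ab aC bC aD bD.
apply/and3P; split.
- by apply/set0Pn; exists a; rewrite inE aC.
- exact: connected_inU aC aD.
apply/forall_inP => v _.
have del (F : {set V}) : connected_in e F ->
    (forall v, v \in F -> connected_in e (F :\ v)) -> connected_in e (F :\ v).
  move=> cF dF; have [/dF//|vF] := boolP (v \in F).
  rewrite (_ : F :\ v = F) //; apply/setP=> z; rewrite !inE.
  by case: eqP => // ->; rewrite (negbTE vF).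
rewrite setDUl; have [av|av] := eqVneq a v.
  by apply: (@connected_inU _ _ b); rewrite ?del // !inE -av eq_sym ab.
by apply: (@connected_inU _ _ a); rewrite ?del // !inE av.
Qed.

End Biconnected.

(** * Joining and gluing transitive orientations *)

Section TransitiveOrientation.
Variables (V : finType) (adj : rel V).
Hypothesis adj_sym : symmetric adj.
Implicit Types (A B H S : {set V}) (o : rel V).

(** For irreflexive [adj] antisymmetry is implied: by transitivity, two opposite arcs would yield a
    loop. *)
Definition transitive_orientation S o : Prop :=
  {in S &, forall x y, adj x y = o x y || o y x} /\ {in S & &, transitive o}.

Lemma transitive_orientation_sub S A o :
  A \subset S -> transitive_orientation S o -> transitive_orientation A o.
Proof.
move=> /subsetP sAS [oP otr]; split; first by move=> x y xA yA; apply: oP; apply: sAS.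
by move=> y x z yA xA zA; apply: otr; apply: sAS.
Qed.

Lemma transitive_orientation_rev S o :
  transitive_orientation S o -> transitive_orientation S (fun x y => o y x).
Proof.
move=> [oP otr]; split=> [x y xS yS /=|y x z yS xS zS /= yx zy].
  by rewrite orbC oP.
exact: (otr y).
Qed.

(** All arcs between the two sets can run from [A] to [B]. The control over [o] on [B] and from [B]
    to [A] lets the construction be repeated along the side of a gall. *)
Lemma transitive_orientation_join A B oA oB b :
  transitive_orientation A oA -> transitive_orientation B oB ->
  [disjoint A & B] -> {in A & B, forall x y, adj x y = b} ->
  exists2 o, transitive_orientation (A :|: B) o &
    {in B &, o =2 oB} /\ {in B & A, forall x y, o x y = false}.
Proof.
move=> [oAP oAtr] [oBP oBtr] dAB adjb.
have BA x : x \in B -> (x \in A) = false by apply: disjointFl.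
pose o := [rel x y | if x \in A then if y \in A then oA x y else b
                     else if y \in A then false else oB x y].
exists o; last first.
  by split=> x y xB yB /=; rewrite (BA x) ?yB ?(BA y).
have oU x : x \in A :|: B -> if x \in A then True else x \in B.
  by rewrite inE; case: (x \in A).
split.
- move=> x y /oU + /oU /=.
  case: (boolP (x \in A)) => xA; case: (boolP (y \in A)) => yA xB yB.
  + exact: oAP.
  + by rewrite adjb ?orbF.
  + by rewrite adj_sym adjb.
  + exact: oBP.
move=> y x z /oU + /oU + /oU /=.
case: (boolP (y \in A)) => yA; case: (boolP (x \in A)) => xA;
  case: (boolP (z \in A)) => zA yB xB zB //.
- exact: oAtr.
- exact: oBtr.
Qed.

(** Two arcs through [H] lead from one side to the other only if [b] is true, and then the arc from
    [A] to [B] is present as well. *)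
Lemma transitive_orientation_glue A B H b :
  [disjoint A & H] -> [disjoint B & H] -> [disjoint A & B] ->
  {in A & B, forall x y, adj x y = b} ->
  (exists oH, transitive_orientation H oH) ->
  (forall S oH, S = A \/ S = B -> transitive_orientation H oH ->
    exists2 o, transitive_orientation (S :|: H) o &
      {in H &, o =2 oH} /\ {in H & S, forall x y, o x y = false}) ->
  exists o, transitive_orientation (A :|: B :|: H) o.
Proof.
move=> dAH dBH dAB adjb [oH oHP] ext.
have [oA oAP [oAH oHA]] := ext A oH (or_introl erefl) oHP.
(* Extensions only come with arcs into [H]. For [b = true] the side [B] is therefore built on the
   reverse of [oH] and reversed back: it still agrees with [oH] on [H], but its arcs leave [H]. *)
pose o1 : rel V := fun x y => if b then oH y x else oH x y.
have o1P : transitive_orientation H o1.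
  by rewrite /o1; case: (b) => //; apply: transitive_orientation_rev.
have [oB0 oB0P [oB0H oHB0]] := ext B o1 (or_intror erefl) o1P.
pose oB : rel V := fun x y => if b then oB0 y x else oB0 x y.
have [oBP oBtr] : transitive_orientation (B :|: H) oB.
  by rewrite /oB; case: (b) => //; apply: transitive_orientation_rev.
have oBH : {in H &, oB =2 oH}.
  move=> x y xH yH; rewrite /oB; move: (oB0H x y xH yH) (oB0H y x yH xH).
  by rewrite /o1; case: (b) => /=.
(* For [b = true] the arcs run from A to H to B, otherwise they run from A and B
   into H. *)
have oHB x y : x \in B -> y \in H -> (if b then oB x y else oB y x) = false.
  by move=> xB yH; rewrite /oB; case: (b) => /=; apply: oHB0.
move: oAP => [oAP oAtr].
have AH x : x \in A -> (x \in H) = false by apply: disjointFr.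
have HA x : x \in H -> (x \in A) = false by apply: disjointFl.
have BH x : x \in B -> (x \in H) = false by apply: disjointFr.
have HB x : x \in H -> (x \in B) = false by apply: disjointFl.
have AB x : x \in A -> (x \in B) = false by apply: disjointFr.
have BA x : x \in B -> (x \in A) = false by apply: disjointFl.
pose o := [rel x y | if x \in A then if y \in B then b else oA x y
  else if x \in B then if y \in A then false else oB x y
  else if y \in B then oB x y else oA x y].
have oU x : x \in A :|: B :|: H ->
    [\/ [/\ x \in A, x \in B = false & x \in H = false],
        [/\ x \in A = false, x \in B & x \in H = false] |
        [/\ x \in A = false, x \in B = false & x \in H]].
  rewrite !inE => /orP[/orP[]|] xS; [apply: Or31|apply: Or32|apply: Or33];
  split=> //; by [apply: AB|apply: AH|apply: BA|apply: BH|apply: HA|apply: HB].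
exists o; split.
- move=> x y /oU[][xA xB xH] /oU[][yA yB yH]; rewrite /= ?xA ?xB ?yA ?yB /=.
  + by apply: oAP; rewrite inE ?xA ?yA.
  + by rewrite orbF adjb.
  + by apply: oAP; rewrite inE ?xA ?yA ?xH ?yH ?orbT.
  + by rewrite adj_sym adjb.
  + by apply: oBP; rewrite inE ?xB ?yB.
  + by apply: oBP; rewrite inE ?xB ?yB ?xH ?yH ?orbT.
  + by apply: oAP; rewrite inE ?xA ?yA ?xH ?yH ?orbT.
  + by apply: oBP; rewrite inE ?xB ?yB ?xH ?yH ?orbT.
  + by apply: oAP; rewrite inE ?xA ?yA ?xH ?yH ?orbT.
move=> y x z yU xU zU.
case: (oU _ yU) (oU _ xU) (oU _ zU) => [][yA yB yH] [][xA xB xH] [][zA zB zH];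
  rewrite /= ?xA ?xB ?yA ?yB ?zA ?zB //=;
  try by [apply: oAtr; rewrite inE ?xA ?yA ?zA ?xH ?yH ?zH ?orbT
         |apply: oBtr; rewrite inE ?xB ?yB ?zB ?xH ?yH ?zH ?orbT].
(* Triples meeting both [B] and [H] remain. Those that also meet [A] are settled by the direction of
   the arcs; in the others [oA] is replaced by [oB] on [H], and [oB] is transitive. *)
- by rewrite oHA.
- by move=> bT; move: (oHB y z yB zH); rewrite bT => ->.
- move=> xy yz; rewrite oAH // -oBH //.
  by apply: (oBtr y) => //; rewrite inE ?xH ?zH ?yB ?orbT.
- by move: (oHB z y zB yH); case: (b) => // ->.
- by rewrite (oHA y).
- move=> xy; rewrite oAH // -oBH //.
  by apply: (oBtr y) => //; rewrite inE ?yH ?zH ?xB ?orbT.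
- rewrite oAH // -oBH //.
  by apply: (oBtr y) => //; rewrite inE ?yH ?xH ?zB ?orbT.
Qed.

End TransitiveOrientation.

Lemma setDUK (T : finType) (A B : {set T}) : B \subset A -> A :\: B :|: B = A.
Proof.
move=> sBA; apply/setP=> x; rewrite !inE.
by case: (boolP (x \in B)) => [/(subsetP sBA)->|]; rewrite ?orbF.
Qed.

(** * Descendants in acyclic digraphs *)

Section Galled.
Variables (V : finType) (e : rel V).
Hypothesis acyclic_e : acyclic e.
Implicit Types (u v w c d h x y : V) (p : seq V).

Local Notation "u ~> v" := (connect e u v) (at level 70).

Lemma not_connect_edge u v : e u v -> v ~> u = false.
Proof. by move/acyclic_e/negbTE. Qed.

Lemma connect_step u v : u ~> v -> u != v -> exists2 c, e u c & c ~> v.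
Proof.
case/connectP=> -[|c p] /= => [_ ->|]; first by rewrite eqxx.
by case/andP=> uc cp -> _; exists c => //; apply/connectP; exists p.
Qed.

Lemma acyclic_path_uniq x p : path e x p -> uniq (x :: p).
Proof.
elim: p x => //= y p IHp x /andP[xy yp].
have := IHp _ yp; rewrite /= => ->; rewrite andbT.
by apply/negP=> /(path_connect yp); rewrite not_connect_edge.
Qed.

Definition descendants v : {set V} := [set w | v ~> w].

(** By acyclicity [u] is no descendant of its child. This count is the measure for the later
    inductions and extremal choices. *)
Lemma edge_card_descendants u v : e u v -> #|descendants v| < #|descendants u|.
Proof.
move=> uv; apply/proper_card/properP; split.
  apply/subsetP=> w; rewrite !inE; exact/connect_trans/connect1.
by exists u; rewrite !inE ?connect0 // not_connect_edge.
Qed.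

Lemma connect_card_descendants u v :
  u ~> v -> #|descendants v| <= #|descendants u|.
Proof.
move=> uv; apply/subset_leq_card/subsetP=> w; rewrite !inE.
exact: connect_trans.
Qed.

(** An ancestor of [v] with the most descendants has no in-neighbour. *)
Lemma unique_source_root r :
  (forall v, indeg e v = 0 -> v = r) -> forall v, r ~> v.
Proof.
move=> source v.
case: (arg_maxnP (fun w => #|descendants w|) (connect0 e v : (fun w => w ~> v) v)).
move=> w wv wmax; rewrite -(source w) //; apply/eqP; rewrite cards_eq0.
apply/set0Pn=> -[u]; rewrite inE => uw.
have /wmax : u ~> v := connect_trans (connect1 uw) wv.
by rewrite /= leqNgt edge_card_descendants.
Qed.

(* The part of the definition of a galled-tree on which the argument rests,
   besides acyclicity; it also covers the one-vertex galled-tree. *)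
Definition galled (r : V) : Prop :=
  [/\ forall v, r ~> v, forall v, indeg e v <= 2 &
   forall C h h', biconnected e C -> indeg e h = 2 -> indeg e h' = 2 ->
     h \in C -> h' \in C -> [set w | e w h] \subset C ->
     [set w | e w h'] \subset C -> h = h'].

(** * Galls and their hybrid-vertices *)

Variable r : V.
Hypothesis galled_e : galled r.

(* [c] and [c'] are the two children of [v] on the cycle closed by [h]: the
   vertex [h] is a topmost common descendant of [c] and [c']. *)
Definition gall v c c' h : Prop :=
  [/\ e v c, e v c', c != c', c ~> h /\ c' ~> h &
      forall w, c ~> w -> c' ~> w -> w ~> h -> w = h].

Lemma gallC v c c' h : gall v c c' h -> gall v c' c h.
Proof.
by case=> vc vc' cc' [ch c'h] hmax; split; rewrite 1?eq_sym // => w ? ?; apply: hmax.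
Qed.

(** Among the common descendants of [c] and [c'] that lie above [w], one with the most descendants
    is topmost. *)
Lemma gall_exists v c c' w :
  e v c -> e v c' -> c != c' -> c ~> w -> c' ~> w ->
  exists2 h, gall v c c' h & h ~> w.
Proof.
move=> vc vc' cc' cw c'w.
pose P h := [&& c ~> h, c' ~> h & h ~> w].
have Pw : P w by rewrite /P cw c'w connect0.
case: (arg_maxnP (fun h => #|descendants h|) Pw) => h /and3P[ch c'h hw] hmax.
exists h => //; split=> // z cz c'z zh.
apply/eqP; apply: contraT => /(connect_step zh)[d zd dh].
have /hmax : P z by rewrite /P cz c'z (connect_trans zh hw).
rewrite /= leqNgt; case/negP.
exact: leq_ltn_trans (connect_card_descendants dh) (edge_card_descendants zd).
Qed.

(** The disjunction separates the path that ends at [c], where the predecessor of [h] is [v] itself,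
    from the longer ones. *)
Lemma path_last_parent v c p h : path e c p -> h = last c p -> e v c ->
  exists q, [/\ e q h, q \in v :: belast c p & (q = v /\ c = h) \/ (c ~> q /\ q <> h)].
Proof.
case/lastP: p => [|p q] /=.
  by move=> _ -> vc; exists v; split=> //; [rewrite inE | left].
rewrite last_rcons rcons_path belast_rcons => /andP[cp pq] -> vc.
exists (last c p); split=> //; first by rewrite in_cons mem_last orbT.
right; split; first by apply: (path_connect cp); rewrite mem_last.
by move=> pqE; move: (not_connect_edge pq); rewrite pqE connect0.
Qed.

(** A shared in-neighbour would be a common descendant of [c] and [c'] strictly above [h], or put
    [v] below its own child, or force [c = c' = h]. *)
Lemma gall_parents v c c' h q q' : gall v c c' h ->
  (q = v /\ c = h) \/ (c ~> q /\ q <> h) ->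
  (q' = v /\ c' = h) \/ (c' ~> q' /\ q' <> h) ->
  e q h -> e q' h -> q != q'.
Proof.
case=> vc vc' cc' [ch c'h] hmax Dq Dq' qh q'h; apply/eqP=> qq'; subst q'.
case: Dq Dq' => [[qv cE]|[cq nq]] [[qv' c'E]|[c'q nq']].
- by rewrite cE c'E eqxx in cc'.
- by rewrite qv (not_connect_edge vc') in c'q.
- by rewrite qv' (not_connect_edge vc) in cq.
- by case: nq; apply: hmax => //; apply: connect1.
Qed.

Lemma pair_parents h q q' : e q h -> e q' h -> q != q' ->
  indeg e h = 2 /\ [set w | e w h] = [set q; q'].
Proof.
move=> qh q'h qq'; case: galled_e => _ /(_ h) le2 _.
have sub : [set q; q'] \subset [set w | e w h].
  by apply/subsetP=> w; rewrite !inE => /orP[]/eqP->.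
have /eqP E : [set q; q'] == [set w | e w h].
  by rewrite eqEcard sub cards2 qq'.
by rewrite /indeg -E cards2 qq'.
Qed.

(** The given path from [c] to [h] and some path from [c'] to [h] meet only in [h], as [h] is
    topmost. With [v] they form a cycle that contains both in-neighbours of [h]. *)
Lemma gall_biconnected v c c' h p : gall v c c' h ->
  path e c p -> h = last c p ->
  exists C : {set V}, [/\ biconnected e C, indeg e h = 2, h \in C,
    [set w | e w h] \subset C & {subset v :: c :: p <= C}].
Proof.
move=> gv cp hE; case: (gv) => vc vc' cc' [ch c'h] hmax.
have /connectP[p' cp' hE'] := c'h.
have [q [qh qp Dq]] := path_last_parent cp hE vc.
have [q' [q'h q'p Dq']] := path_last_parent cp' hE' vc'.
have qq' := gall_parents gv Dq Dq' qh q'h.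
have [h2 hq] := pair_parents qh q'h qq'.
(* Down one side to [h] and back up the other; [belast] keeps [h] from occurring twice. *)
pose s := (c :: p) ++ rev (belast c' p').
have Cs : {subset v :: c :: p <= [set z in v :: s]}.
  by move=> z zp; rewrite /s inE -cat_cons mem_cat zp.
exists [set z in v :: s]; split=> //; last first.
- rewrite hq; apply/subsetP=> z; case/set2P=> ->.
    have/mem_belast : q \in belast v (c :: p) by [].
    exact: Cs.
  move: q'p; rewrite in_set !in_cons /s mem_cat mem_rev.
  by case/orP=> ->; rewrite ?orbT.
- by apply: Cs; rewrite hE in_cons mem_last orbT.
apply: cycle_biconnected.
- rewrite cat_path.
  have sub : subrel e (underlying e) by move=> a b ab; rewrite /underlying /= ab.
  have -> /= : path (underlying e) v (c :: p).
    by rewrite /= (sub _ _ vc) (sub_path sub cp).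
  rewrite -hE hE' rev_path; apply: sub_path cp' => a b ab.
  by rewrite /underlying /= ab orbT.
- rewrite last_cat /= -hE /underlying /=; case: (p') hE' => [|y q0] /= => [->|_].
    by rewrite vc' orbT.
  by rewrite rev_cons last_rcons vc' orbT.
rewrite cons_uniq mem_cat mem_rev cat_uniq rev_uniq.
rewrite (acyclic_path_uniq cp) /=.
have Up' := acyclic_path_uniq cp'.
have hb : h \notin belast c' p'.
  by move: Up'; rewrite lastI rcons_uniq -hE' => /andP[].
have -> : uniq (belast c' p').
  by move: Up'; rewrite lastI rcons_uniq => /andP[].
have [vD vD'] := (not_connect_edge vc, not_connect_edge vc').
rewrite andbT; apply/andP; split.
  rewrite negb_or; apply/andP; split.
    by apply/negP=> /(path_connect cp); rewrite vD.
  by apply/negP=> /mem_belast/(path_connect cp'); rewrite vD'.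
rewrite has_rev; apply/hasPn => z zb.
apply: contra hb => /= zp; rewrite -(hmax z) //; first exact: path_connect zp.
  exact: path_connect (mem_belast zb).
by rewrite hE path_connect_last.
Qed.

(** The two cycles share the vertices [u] and [d], so their union is biconnected, and (N4)
    identifies the two hybrid-vertices. *)
Lemma gall_shared_edge v c c' h p u d d' w :
  gall v c c' h -> path e c p -> h = last c p ->
  gall u d d' w -> u \in v :: c :: p -> d \in v :: c :: p -> w = h.
Proof.
move=> gv cp hE gu up dp.
have [C [bC h2 hC pC sC]] := gall_biconnected gv cp hE.
have [ud _ _ [/connectP[p' dp' wE] _] _] := gu.
have [D [bD w2 wD pD sD]] := gall_biconnected gu dp' wE.
have neq : u != d.
  by apply/eqP=> uE; move: (not_connect_edge ud); rewrite uE connect0.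
have bCD : biconnected e (C :|: D).
  by apply: (biconnectedU bC bD neq); rewrite ?sC ?sD // !in_cons eqxx ?orbT.
case: galled_e => _ _ /(_ _ w h bCD) -> //; rewrite ?in_setU ?hC ?wD ?orbT //.
  exact: subset_trans pD (subsetUr _ _).
exact: subset_trans pC (subsetUl _ _).
Qed.

Lemma gall_same_child v c c' d' h w : gall v c c' h -> gall v c d' w -> w = h.
Proof.
move=> gv gw; case: (gv) => _ _ _ [/connectP[p cp hE] _] _.
by apply: (gall_shared_edge gv cp hE gw); rewrite !inE eqxx ?orbT.
Qed.

(** Each common descendant lies below the end of some gall on [c] and [c'], and all of these galls
    end in [h]. *)
Lemma gall_meet v c c' h w : gall v c c' h -> (c ~> w) && (c' ~> w) = (h ~> w).
Proof.
move=> gv; case: (gv) => vc vc' cc' [ch c'h] hmax.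
apply/andP/idP => [[cw c'w] | hw]; last by split; apply: connect_trans hw.
have [h' gv' h'w] := gall_exists vc vc' cc' cw c'w.
by rewrite -(gall_same_child gv gv').
Qed.

Lemma parent_of v c h : e v c -> c ~> h ->
  exists2 q, e q h & (q = v /\ c = h) \/ (c ~> q /\ q <> h).
Proof.
move=> vc /connectP[p cp hE].
by have [q [? _ ?]] := path_last_parent cp hE vc; exists q.
Qed.

Lemma three_parents h q1 q2 q3 :
  e q1 h -> e q2 h -> e q3 h -> q1 != q2 -> q1 != q3 -> q2 != q3 -> False.
Proof.
move=> h1 h2 h3 n12 n13 n23; have [_ E] := pair_parents h1 h2 n12.
have : q3 \in [set w | e w h] by rewrite inE.
by rewrite E => /set2P[] E3; move: n13 n23; rewrite E3 eqxx.
Qed.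

(** Otherwise any two of the three children would close a gall in the same vertex [h], which would
    then have three in-neighbours. *)
Lemma third_child_disjoint v c c' d w z :
  e v c -> e v c' -> e v d -> c != c' -> c != d -> c' != d ->
  c ~> w -> c' ~> w -> c ~> z -> d ~> z -> False.
Proof.
move=> vc vc' vd cc' cd c'd cw c'w cz dz.
have [h gh _] := gall_exists vc vc' cc' cw c'w.
have [h' gh' _] := gall_exists vc vd cd cz dz.
have hh' := gall_same_child gh gh'; subst h'.
case: (gh) (gh') => _ _ _ [ch c'h] _ [_ _ _ [_ dh] _].
have [h' gh'' _] := gall_exists vc' vd c'd c'h dh.
have hh' := gall_same_child (gallC gh) gh''; subst h'.
have [q1 e1 Q1] := parent_of vc ch.
have [q2 e2 Q2] := parent_of vc' c'h.
have [q3 e3 Q3] := parent_of vd dh.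
exact: (three_parents e1 e2 e3 (gall_parents gh Q1 Q2 e1 e2)
  (gall_parents gh' Q1 Q3 e1 e3) (gall_parents gh'' Q2 Q3 e2 e3)).
Qed.

(** A gall at [u] through [d] shares an arc with the given gall, hence also ends in [h]. Its two
    sides and the side of [c'] would supply three in-neighbours of [h]. *)
Lemma gall_side_disjoint v c c' h u d d' z :
  gall v c c' h -> c ~> u -> e u d -> e u d' -> d != d' -> d ~> h ->
  d ~> z -> d' ~> z -> False.
Proof.
move=> gv cu ud ud' dd' dh dz d'z.
have [w gu _] := gall_exists ud ud' dd' dz d'z.
have [p1 cp1 uE] := connectP cu.
have [p2 dp2 hE] := connectP dh.
have cp : path e c (p1 ++ d :: p2) by rewrite cat_path cp1 /= -uE ud.
have hE' : h = last c (p1 ++ d :: p2) by rewrite last_cat.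
have wh : w = h.
  apply: (gall_shared_edge gv cp hE' gu).
    by rewrite in_cons -cat_cons mem_cat uE mem_last orbT.
  by rewrite in_cons -cat_cons mem_cat mem_head !orbT.
subst w.
have [_ _ _ [_ d'h] _] := gu.
have [vc vc' _ [_ c'h] _] := gv.
have [q1 e1 Q1] := parent_of ud dh.
have [q2 e2 Q2] := parent_of ud' d'h.
have [q3 e3 Q3] := parent_of vc' c'h.
(* In-neighbours of [h] reached through [u] lie on the side of [c], hence differ from the one on the
   side of [c']. *)
have side d0 q : e u d0 -> e q h -> (q = u /\ d0 = h) \/ (d0 ~> q /\ q <> h) ->
    (q = v /\ c = h) \/ (c ~> q /\ q <> h).
  move=> ud0 qh Q; right; split; last first.
    by move=> qE; move: (not_connect_edge qh); rewrite qE connect0.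
  case: Q => [[-> _]//|[d0q _]].
  exact: connect_trans (connect_trans cu (connect1 ud0)) d0q.
apply: (three_parents e1 e2 e3 (gall_parents gu Q1 Q2 e1 e2)).
  exact: (gall_parents gv (side _ _ ud e1 Q1) Q3 e1 e3).
exact: (gall_parents gv (side _ _ ud' e2 Q2) Q3 e2 e3).
Qed.

(** * Lowest common ancestors *)

Lemma min_common_ancestor_exists w u u' : w ~> u -> w ~> u' ->
  exists2 s, w ~> s & min_common_ancestor e u u' s.
Proof.
move=> wu wu'.
pose P s := (w ~> s) && common_ancestor e u u' s.
have Pw : P w by rewrite /P /common_ancestor connect0 wu wu'.
case: (arg_minnP (fun h => #|descendants h|) Pw) => s /andP[ws cs] smin.
exists s => //; rewrite /min_common_ancestor cs /=.
apply/forallP=> z; apply/implyP=> cz; apply/implyP=> sz.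
rewrite eq_sym; apply: contraT => /(connect_step sz)[d sd dz].
have /smin : P z by rewrite /P cz (connect_trans ws sz).
rewrite /= leqNgt; case/negP.
exact: leq_ltn_trans (connect_card_descendants dz) (edge_card_descendants sd).
Qed.

Lemma min_common_ancestorP u u' s : reflect
  [/\ s ~> u, s ~> u' & forall c, e s c -> c ~> u -> c ~> u' -> False]
  (min_common_ancestor e u u' s).
Proof.
apply: (iffP andP) => [[/andP[su su'] /forallP smin] | [su su' smin]].
  split=> // c sc cu cu'; move: (smin c).
  rewrite /common_ancestor cu cu' (connect1 sc) /= => /eqP cE.
  by move: (not_connect_edge sc); rewrite cE connect0.
split; first by rewrite /common_ancestor su su'.
apply/forallP=> z; apply/implyP=> /andP[zu zu']; apply/implyP=> sz.
rewrite eq_sym; apply: contraT => /(connect_step sz)[d sd dz].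
by case: (smin d sd); apply: connect_trans dz _.
Qed.

(** Otherwise the ways from [c] to [u] and to [h] part at some [s] into different children that both
    reach [x], against [gall_side_disjoint]. *)
Lemma gall_comparable v c c' h u x :
  gall v c c' h -> c ~> u -> u ~> x -> h ~> x -> (u ~> h) || (h ~> u).
Proof.
move=> gv cu ux hx; case: (gv) => _ _ _ [ch _] _.
have [s cs /min_common_ancestorP[su sh smin]] := min_common_ancestor_exists cu ch.
have [<-|nsu] := eqVneq s u; first by rewrite sh.
have [<-|nsh] := eqVneq s h; first by rewrite su orbT.
have [d sd du] := connect_step su nsu.
have [d' sd' d'h] := connect_step sh nsh.
have dd' : d' != d by apply/eqP=> dE; apply: (smin d) => //; rewrite -dE.
case: (gall_side_disjoint gv cs sd' sd dd' d'h (connect_trans d'h hx)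
  (connect_trans du ux)).
Qed.

(** If the ways to [v] and [v'] part at [s], the gall at [s] ends in some [h] above both [x] and
    [y]. Minimality of [v] and comparability place [v] at or below [h], hence below both children of
    [s], against the choice of [s]. *)
Lemma min_common_ancestor_uniq x y v v' :
  min_common_ancestor e x y v -> min_common_ancestor e x y v' -> v = v'.
Proof.
move=> mv mv'.
have minP s z : min_common_ancestor e x y s -> s ~> z -> z ~> x -> z ~> y -> z = s.
  case/andP=> _ /forallP/(_ z) + sz zx zy.
  by rewrite /common_ancestor zx zy sz => /eqP.
have [rootP _ _] := galled_e.
have [s _ /min_common_ancestorP[sv sv' smin]] :=
  min_common_ancestor_exists (rootP v) (rootP v').
have [vx vy _] := min_common_ancestorP _ _ _ mv.
have [v'x v'y _] := min_common_ancestorP _ _ _ mv'.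
have [sE|nsv] := eqVneq s v; first by apply/esym/(minP v) => //; rewrite -sE.
have [sE|nsv'] := eqVneq s v'; first by apply/(minP v') => //; rewrite -sE.
have [c sc cv] := connect_step sv nsv.
have [c' sc' c'v'] := connect_step sv' nsv'.
have cc' : c != c' by apply/eqP=> cE; apply: (smin c) => //; rewrite cE.
have [h gs hx] := gall_exists sc sc' cc' (connect_trans cv vx) (connect_trans c'v' v'x).
have hy : h ~> y.
  by rewrite -(gall_meet y gs) (connect_trans cv vy) (connect_trans c'v' v'y).
have [_ _ _ [_ c'h] _] := gs.
have c'v : c' ~> v.
  have /orP[vh|] := gall_comparable gs cv vx hx; last exact: connect_trans c'h.
  by rewrite -(minP v h).
by case: (smin c').
Qed.

Lemma lcaE x y v : min_common_ancestor e x y v -> lca e x y = Some v.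
Proof.
rewrite /lca => mv; case: pickP => [w mw|/(_ v)]; last by rewrite mv.
by rewrite (min_common_ancestor_uniq mv mw).
Qed.

(** A child of [v] above both [x] and [y] would be a third child, meeting [c] in [x] and [c'] in
    [y]. *)
Lemma lca_children v c c' x y : e v c -> e v c' -> c ~> x -> c' ~> y ->
  ~~ (c ~> y) -> ~~ (c' ~> x) -> lca e x y = Some v.
Proof.
move=> vc vc' cx c'y ncy nc'x; apply: lcaE; apply/min_common_ancestorP; split.
- exact: connect_trans (connect1 vc) cx.
- exact: connect_trans (connect1 vc') c'y.
move=> d vd dx dy.
have cd : d != c by apply/eqP=> dE; rewrite dE in dy; rewrite dy in ncy.
have c'd : d != c' by apply/eqP=> dE; rewrite dE in dx; rewrite dx in nc'x.
have cc' : c != c' by apply/eqP=> cE; rewrite cE c'y in ncy.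
exact: (third_child_disjoint vd vc vc' cd c'd cc' dx cx dy c'y).
Qed.

Lemma lca_exists x y : exists v, lca e x y = Some v.
Proof.
have [rootP _ _] := galled_e.
have [s _ ms] := min_common_ancestor_exists (rootP x) (rootP y).
by exists s; apply: lcaE.
Qed.

Lemma min_common_ancestorC x y v :
  min_common_ancestor e x y v = min_common_ancestor e y x v.
Proof.
rewrite /min_common_ancestor /common_ancestor (andbC (v ~> x)); congr (_ && _).
by apply: eq_forallb => w; rewrite (andbC (w ~> x)).
Qed.

Lemma lcaC x y : lca e x y = lca e y x.
Proof. by apply: eq_pick => v; apply: min_common_ancestorC. Qed.

(** * Orienting the graph on the leaves *)

Variables (X : {set V}) (g : V -> bool).
Hypothesis leafX : forall x c, x \in X -> ~~ e x c.

(** With a boolean [g] in place of the labels, complementing the graph on the leaves amounts to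
    negating [g]. *)
Definition lca_adj : rel V :=
  fun x y => (x != y) && oapp g false (lca e x y).

Lemma lca_adj_sym : symmetric lca_adj.
Proof. by move=> x y; rewrite /lca_adj eq_sym lcaC. Qed.

Lemma lca_adj_irr : irreflexive lca_adj.
Proof. by move=> x; rewrite /lca_adj eqxx. Qed.

Lemma lca_adj_children v c c' x y : e v c -> e v c' -> c ~> x -> c' ~> y ->
  ~~ (c ~> y) -> ~~ (c' ~> x) -> lca_adj x y = g v.
Proof.
move=> vc vc' cx c'y ncy nc'x; rewrite /lca_adj (lca_children vc vc') //=.
by case: eqVneq => // xy; rewrite -xy cx in ncy.
Qed.

Definition leaves v : {set V} := X :&: descendants v.

Lemma in_leaves v x : (x \in leaves v) = (x \in X) && (v ~> x).
Proof. by rewrite !inE. Qed.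

Lemma leaves_sub u v : u ~> v -> leaves v \subset leaves u.
Proof.
move=> uv; apply/subsetP=> x; rewrite !in_leaves => /andP[-> vx].
exact: connect_trans uv vx.
Qed.

Lemma leaf_step v d x : e v d -> x \in leaves v -> exists2 c, e v c & c ~> x.
Proof.
move=> vd; rewrite in_leaves => /andP[xX vx]; apply: connect_step => //.
by apply/eqP=> vE; move: (leafX d xX); rewrite -vE vd.
Qed.

(* Moving up one side of a gall, the leaves hanging off the side at [u] are
   joined uniformly to everything further down, so all arcs can point down. *)
Lemma gall_side_orientation v c c' h oH : gall v c c' h ->
  (forall w, c ~> w -> exists o, transitive_orientation lca_adj (leaves w) o) ->
  transitive_orientation lca_adj (leaves h) oH ->
  forall u, c ~> u -> u ~> h ->
  exists2 o, transitive_orientation lca_adj (leaves u) o &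
    {in leaves h &, o =2 oH} /\
    {in leaves h & leaves u :\: leaves h, forall x y, o x y = false}.
Proof.
move=> gv orient oHP u.
have [n] := ubnP #|descendants u|; elim: n u => // n IHn u le_n cu uh.
have [->|nuh] := eqVneq u h.
  by exists oH; rewrite // setDv; split=> // x y _; rewrite in_set0.
have [d ud dh] := connect_step uh nuh.
have [|oD oDP [oDh ohD]] := IHn d _ (connect_trans cu (connect1 ud)) dh.
  exact: leq_trans (edge_card_descendants ud) le_n.
(* The leaves that hang off at [u] take over an arbitrary orientation of the leaves below [u]. *)
have [o0 o0P] := orient u cu.
have subd := leaves_sub (connect1 ud).
have oRP := transitive_orientation_sub (subsetDl _ (leaves d)) o0P.
have dis : [disjoint leaves u :\: leaves d & leaves d].
  by rewrite disjoints_subset setDE subsetIr.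
have adjb : {in leaves u :\: leaves d & leaves d, forall x y, lca_adj x y = g u}.
  move=> x y /setDP[xu nxd]; rewrite in_leaves => /andP[yX dy].
  have [d' ud' d'x] := leaf_step ud xu.
  have ndx : ~~ (d ~> x).
    by move: xu nxd; rewrite !in_leaves => /andP[-> _].
  have dd' : d != d' by apply/eqP=> dE; rewrite dE d'x in ndx.
  apply: (lca_adj_children ud' ud) => //; apply/negP=> d'y.
  exact: (gall_side_disjoint gv cu ud ud' dd' dh dy d'y).
have [o oP [oD' oR]] := transitive_orientation_join lca_adj_sym oRP oDP dis adjb.
have /subsetP subh := leaves_sub dh.
exists o; first by rewrite setDUK in oP.
split=> [x y xh yh|x y xh /setDP[yu nyh]]; first by rewrite oD' ?subh ?oDh.
have [yd|nyd] := boolP (y \in leaves d).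
  by rewrite oD' ?(subh _ xh) // ohD // inE nyh.
by rewrite oR ?(subh _ xh) // inE nyd.
Qed.

Lemma children_leaves_disjoint v c c' :
  e v c -> e v c' -> c != c' -> ~~ [exists w, (c ~> w) && (c' ~> w)] ->
  [disjoint leaves c & leaves c'] /\
  {in leaves c & leaves c', forall x y, lca_adj x y = g v}.
Proof.
move=> vc vc' cc' /existsPn dis.
split.
  rewrite -setI_eq0; apply/eqP/setP=> x; rewrite in_setI !in_leaves inE.
  by move: (dis x); case: (c ~> x); case: (c' ~> x); rewrite ?andbF.
move=> x y; rewrite !in_leaves => /andP[_ cx] /andP[_ c'y].
apply: (lca_adj_children vc vc') => //.
  by move: (dis y); rewrite c'y andbT.
by move: (dis x); rewrite cx.
Qed.

(** The sets to be glued are the leaves below [h] and the remaining leaves of either side. By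
    [gall_meet] the sides are disjoint off [h] and see each other through [v]. *)
Lemma gall_leaves_orientation v c c' h : gall v c c' h ->
  (forall w, e v c -> c ~> w ->
    exists o, transitive_orientation lca_adj (leaves w) o) ->
  (forall w, e v c' -> c' ~> w ->
    exists o, transitive_orientation lca_adj (leaves w) o) ->
  exists o, transitive_orientation lca_adj (leaves c :|: leaves c') o.
Proof.
move=> gv orc orc'; case: (gv) => vc vc' _ [ch c'h] _.
have [sub sub'] := (leaves_sub ch, leaves_sub c'h).
have -> : leaves c :|: leaves c' =
    (leaves c :\: leaves h) :|: (leaves c' :\: leaves h) :|: leaves h.
  by rewrite -setDUl setDUK // (subset_trans sub) // subsetUl.
have notc z d : z \in leaves d :\: leaves h -> h ~> z = false.
  by rewrite inE !in_leaves => /and3P[+ zX _]; rewrite zX => /negbTE.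
have inc z d : z \in leaves d :\: leaves h -> d ~> z.
  by case/setDP=> +_; rewrite in_leaves => /andP[].
apply: (transitive_orientation_glue lca_adj_sym (b := g v)) => //.
- by rewrite disjoints_subset setDE subsetIr.
- by rewrite disjoints_subset setDE subsetIr.
- rewrite -setI_eq0; apply/eqP/setP=> z; rewrite in_setI in_set0.
  apply/andP=> -[zc zc']; move: (notc _ _ zc).
  by rewrite -(gall_meet z gv) (inc _ _ zc) (inc _ _ zc').
- move=> x y xc yc'; apply: (lca_adj_children vc vc' (inc _ _ xc) (inc _ _ yc')).
    have := notc _ _ yc'; rewrite -(gall_meet y gv) (inc _ _ yc') andbT.
    by move->.
  by have := notc _ _ xc; rewrite -(gall_meet x gv) (inc _ _ xc) => /= ->.
- exact: orc.
move=> S oH [] -> oHP; rewrite setDUK //.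
  exact: (gall_side_orientation gv (fun w => orc w vc) oHP (connect0 _ _) ch).
exact: (gall_side_orientation (gallC gv) (fun w => orc' w vc') oHP (connect0 _ _) c'h).
Qed.

(** The children of [v] fall into single ones and pairs closing a gall. Leaves from different such
    groups have lca [v], so the groups can be joined one after another. *)
Lemma leaves_orientation v :
  exists o, transitive_orientation lca_adj (leaves v) o.
Proof.
have [n] := ubnP #|descendants v|; elim: n v => // n IHn v le_n.
have below c w : e v c -> c ~> w ->
    exists o, transitive_orientation lca_adj (leaves w) o.
  move=> vc cw; apply: IHn; apply: leq_ltn_trans (connect_card_descendants cw) _.
  exact: leq_trans (edge_card_descendants vc) le_n.
have [/existsP[d vd]|/existsPn nov] := boolP [exists d, e v d]; last first.
  exists (fun _ _ => false); split=> // x y; rewrite !in_leaves.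
  have leaf z : v ~> z -> z = v.
    move=> vz; apply/eqP; rewrite eq_sym; apply: contraT => /(connect_step vz)[c vc].
    by rewrite (negbTE (nov c)) in vc.
  by move=> /andP[_ /leaf->] /andP[_ /leaf->]; rewrite lca_adj_irr.
have -> : leaves v = \bigcup_(c in [set c | e v c]) leaves c.
  apply/setP=> x; apply/idP/bigcupP=> [xv|[c]].
    have [c vc cx] := leaf_step vd xv.
    by exists c; rewrite ?inE //; move: xv; rewrite !in_leaves cx => /andP[-> _].
  by rewrite inE => vc; apply/subsetP/leaves_sub/connect1.
have : {in [set c | e v c], forall c, e v c} by move=> c; rewrite inE.
(* Arbitrary sets of children are allowed, so that one child or a pair can be split off at a
   time. *)
move: [set c | e v c] => S; have [m] := ubnP #|S|; elim: m S => // m IHm S le_m vS.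
have [->|/set0Pn[c cS]] := eqVneq S set0.
  by exists (fun _ _ => false); rewrite big_set0; split=> x y; rewrite inE.
have vc := vS c cS.
have cm : #|S :\ c| < m by move: le_m; rewrite (cardsD1 c) cS.
have vSc : {in S :\ c, forall c', e v c'} by move=> c' /setD1P[_]; apply: vS.
pose meets c1 c2 := [exists w, (c1 ~> w) && (c2 ~> w)].
(* [Y] stands for the leaves of the group split off, and [S'] for the children left over. *)
have far (Y S' : {set V}) : S' \subset S ->
    (forall y, y \in Y -> exists2 c1, c1 \in S :\: S' & y \in leaves c1) ->
    {in S :\: S' & S', forall c1 c2, ~~ meets c1 c2} ->
    [disjoint Y & \bigcup_(c in S') leaves c] /\
    {in Y & \bigcup_(c in S') leaves c, forall x y, lca_adj x y = g v}.
  move=> /subsetP sS' YS nmeet.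
  have sep x c2 : x \in Y -> c2 \in S' -> exists c1,
      [/\ x \in leaves c1, [disjoint leaves c1 & leaves c2] &
      {in leaves c1 & leaves c2, forall x y, lca_adj x y = g v}].
    move=> /YS[c1 c1S xc1] c2S; exists c1; move: (c1S); case/setDP=> c1S' nc1.
    have c12 : c1 != c2 by apply: contraNneq nc1 => ->.
    have [] := children_leaves_disjoint (vS _ c1S') (vS _ (sS' _ c2S)) c12
      (nmeet _ _ c1S c2S).
    by split.
  split=> [|x y xY /bigcupP[c2 c2S yc2]].
    rewrite disjoint_subset; apply/subsetP=> x xY; rewrite inE.
    apply/bigcupP=> -[c2 /(sep x _ xY)[c1 [xc1 dis _]] xc2].
    by rewrite (disjointFr dis xc1) in xc2.
  by have [c1 [xc1 _]] := sep x c2 xY c2S; apply.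
have [/existsP[c' /andP[c'S cc']]|/existsPn alone] :=
    boolP [exists c', (c' \in S :\ c) && meets c c'].
  have vc' := vSc c' c'S; have /setD1P[nc'c c'S'] := c'S.
  have /existsP[w /andP[cw c'w]] := cc'.
  have ncc' : c != c' by rewrite eq_sym.
  have [h gv hw] := gall_exists vc vc' ncc' cw c'w.
  have [oY oYP] := gall_leaves_orientation gv (below c) (below c').
  have [||oS oSP] := IHm (S :\ c :\ c').
  - exact: leq_ltn_trans (subset_leq_card (subD1set _ _)) cm.
  - by move=> c1 /setD1P[_]; apply: vSc.
  have [|||dis adjb] := far (leaves c :|: leaves c') (S :\ c :\ c').
  - exact: subset_trans (subD1set _ _) (subD1set _ _).
  - move=> y /setUP[yc|yc']; [exists c | exists c'] => //.
      by rewrite !inE eqxx andbF cS.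
    by rewrite !inE eqxx c'S'.
  - move=> c1 c2 /setDP[c1S]; rewrite 4!inE c1S andbT -negb_or negbK => c1cc'.
    rewrite !inE => /and3P[nc2c' nc2c c2S].
    have vc2 := vS c2 c2S; have [nc2 nc'2] : c != c2 /\ c' != c2 by rewrite !(eq_sym _ c2).
    apply/existsP=> -[z /andP[c1z c2z]].
    case/orP: c1cc' => /eqP c1E; rewrite c1E in c1z.
      exact: (third_child_disjoint vc' vc vc2 nc'c nc'2 nc2 c'w cw c1z c2z).
    exact: (third_child_disjoint vc vc' vc2 ncc' nc2 nc'2 cw c'w c1z c2z).
  have [o oP _] := transitive_orientation_join lca_adj_sym oYP oSP dis adjb.
  by exists o; rewrite (big_setD1 c) // (big_setD1 c') //= setUA.
have [oc ocP] := below c c vc (connect0 _ _).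
have [oS oSP] := IHm _ cm vSc.
have [||dis adjb] := far (leaves c) (S :\ c) (subD1set _ _).
- by move=> y yc; exists c; rewrite // !inE eqxx cS.
- move=> c1 c2 /setDP[c1S]; rewrite !inE c1S andbT negbK => /eqP-> c2S.
  by have := alone c2; rewrite !inE c2S.
have [o oP _] := transitive_orientation_join lca_adj_sym ocP oSP dis adjb.
by exists o; rewrite (big_setD1 c).
Qed.

Lemma leaves_root : leaves r = X.
Proof.
have [rootP _ _] := galled_e.
by apply/setP=> x; rewrite in_leaves rootP andbT.
Qed.

End Galled.

(** Every biconnected set lies in a biconnected component, which carries (N4) over from components
    to all biconnected sets. *)
Lemma galled_tree_galled (V : finType) (e : rel V) (X : {set V}) :
  galled_tree e X ->
  [/\ acyclic e, forall x c, x \in X -> ~~ e x c & exists r, galled e r].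
Proof.
case=> _ acyc [[x [-> VE noe]]|[r [[r0 _ source] leafP innerP bicP]]]; split=> //.
- have all_x v : v = x by apply/set1P; rewrite -VE inE.
  have in0 v : indeg e v = 0.
    by apply/eqP; rewrite cards_eq0; apply/set0Pn=> -[u]; rewrite inE (negbTE (noe _ _)).
  by exists x; split=> [v|v|C h h' _]; rewrite ?(all_x v) ?connect0 ?in0.
- move=> x c /leafP[/eqP + _]; rewrite cards_eq0 => /eqP/setP/(_ c).
  by rewrite !inE => ->.
have deg v : indeg e v <= 1 \/ hybrid e v.
  have [->|vr] := eqVneq v r; first by rewrite r0; left.
  have [/leafP[_ ->]|vX] := boolP (v \in X); first by left.
  by have [[-> _]|] := innerP v vr vX; [left|right].
have hyb v : indeg e v = 2 -> hybrid e v by case: (deg v) => // + v2; rewrite v2.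
exists r; split.
- exact: unique_source_root.
- by move=> v; case: (deg v) => [/leqW//|/andP[/eqP-> _]].
move=> C h h' bC h2 h'2 hC h'C pC p'C.
have [D mD /subsetP CD] := maxset_exists bC; have sCD := introT subsetP CD.
by apply: (bicP D mD); rewrite /hybrid_of hyb ?CD //= (subset_trans _ sCD).
Qed.

(** * Permutation graphs from pairs of orientations *)

(** The rank of an element is the number of elements below it. *)
Lemma strict_order_rank (T : finType) (lt : rel T) :
  irreflexive lt -> transitive lt ->
  (forall x y, x != y -> lt x y || lt y x) ->
  exists2 l : T -> 'I_#|T|, bijective l & forall x y, lt x y = (l x < l y).
Proof.
move=> ltxx ltT total.
pose below x := [set y | lt y x].
have below_lt x : #|below x| < #|T|.
  rewrite -cardsT; apply/proper_card/properP; split; first exact: subsetT.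
  by exists x; rewrite !inE ?ltxx.
have mono x y : lt x y -> #|below x| < #|below y|.
  move=> xy; apply/proper_card/properP; split.
    by apply/subsetP=> z; rewrite !inE => zx; apply: ltT xy.
  by exists x; rewrite !inE ?ltxx.
pose l x := Ordinal (below_lt x).
exists l.
  apply: inj_card_bij; last by rewrite card_ord.
  move=> x y /(congr1 val) /= lE; apply/eqP; apply: contraT => /total.
  by case/orP=> /mono; rewrite lE ltnn.
move=> x y /=; apply/idP/idP; first exact: mono.
apply: contraLR => nxy; rewrite -leqNgt.
have [->//|/total] := eqVneq x y.
by rewrite (negbTE nxy) /= => /mono/ltnW.
Qed.

(** In a directed triangle two consecutive arcs would come from the same orientation, and its
    transitivity would contradict the third arc. *)
Lemma orientation_union_order (T : finType) (adj o o' : rel T) :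
  irreflexive adj ->
  transitive_orientation adj [set: T] o ->
  transitive_orientation [rel x y | (x != y) && ~~ adj x y] [set: T] o' ->
  [/\ irreflexive [rel x y | o x y || o' x y],
      transitive [rel x y | o x y || o' x y] &
      forall x y, x != y -> [|| o x y, o' x y, o y x | o' y x]].
Proof.
move=> adjxx [oP otr] [oP' otr'].
have {}oP x y : adj x y = o x y || o y x by apply: oP; rewrite inE.
have {}oP' x y : (x != y) && ~~ adj x y = o' x y || o' y x.
  by rewrite -oP' // inE.
have {}otr x y z : o x y -> o y z -> o x z by apply: otr; rewrite inE.
have {}otr' x y z : o' x y -> o' y z -> o' x z by apply: otr'; rewrite inE.
have oxx x : o x x = false by have := oP x x; rewrite adjxx; case: (o x x).
have oxx' x : o' x x = false.
  by have := oP' x x; rewrite eqxx; case: (o' x x).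
have excl x y : o x y -> o' x y || o' y x -> False.
  by rewrite -oP' oP => ->; rewrite andbF.
have total x y : x != y -> [|| o x y, o' x y, o y x | o' y x].
  move=> xy; have := oP' x y; rewrite xy oP /=.
  by case: (o x y); case: (o y x); rewrite ?orbT //= => ->.
split=> [x|y x z /=|//]; first by rewrite /= oxx oxx'.
have [<-|xz] := eqVneq x z.
  case/orP=> xy /orP[] yx.
  - by rewrite (otr _ _ _ xy yx).
  - by case: (excl _ _ xy); rewrite yx orbT.
  - by case: (excl _ _ yx); rewrite xy orbT.
  - by rewrite (otr' _ _ _ xy yx) orbT.
case/orP=> xy /orP[] yz.
- by rewrite (otr _ _ _ xy yz).
- have /or4P[->|->|zx|zx] := total _ _ xz; rewrite ?orbT //.
    by case: (excl _ _ (otr _ _ _ zx xy)); rewrite yz orbT.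
  by case: (excl _ _ xy); rewrite (otr' _ _ _ yz zx) orbT.
- have /or4P[->|->|zx|zx] := total _ _ xz; rewrite ?orbT //.
    by case: (excl _ _ (otr _ _ _ yz zx)); rewrite xy orbT.
  by case: (excl _ _ yz); rewrite (otr' _ _ _ zx xy) orbT.
- by rewrite (otr' _ _ _ xy yz) orbT.
Qed.

Lemma permutation_graph_orientations (T : finType) (adj o o' : rel T) :
  irreflexive adj ->
  transitive_orientation adj [set: T] o ->
  transitive_orientation [rel x y | (x != y) && ~~ adj x y] [set: T] o' ->
  permutation_graph adj.
Proof.
move=> adjxx oP oP'.
have oPr := transitive_orientation_rev oP.
have [irr1 tr1 tot1] := orientation_union_order adjxx oP oP'.
have [irr2 tr2 tot2] := orientation_union_order adjxx oPr oP'.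
have [|l lbij lE] := strict_order_rank irr1 tr1.
  by move=> x y /tot1 /=; rewrite -!orbA.
have [|m mbij mE] := strict_order_rank irr2 tr2.
  by move=> x y /tot2 /=; rewrite -!orbA.
have [l' lK l'K] := lbij.
have f_inj : injective (m \o l').
  by apply: inj_comp; [exact: bij_inj mbij | exact: can_inj l'K].
(* The inverse of the chosen permutation sends [l u] to [m u], so the inversions are the pairs that
   [l] and [m] order differently. *)
exists l, (perm f_inj)^-1%g; split=> // u v uv; rewrite invgK !permE /= !lK.
rewrite -!lE -!mE /=.
have [/(_ u v (in_setT u) (in_setT v)) -> _] := oP.
(* On a nonadjacent pair both orders follow [o'], so an inversion there would need both directions
   in [o']. *)
have asym : o' u v -> o' v u -> False.
  by move=> uv' vu'; have := irr1 u; rewrite (tr1 v) //= ?uv' ?vu' orbT.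
move: asym; case: (o u v); case: (o v u); case: (o' u v); case: (o' v u) => asym;
  split=> //; by [tauto | case: asym].
Qed.

Theorem mainTheorem10 (T : finType) (adj : rel T) :
  simple_graph adj -> GaTEx adj -> permutation_graph adj.
Proof.
move=> [_ adjxx] [V [e [X [t [/galled_tree_galled[acyc leafX [r gal]] _ [f fbij fE]]]]]].
pose g v := if t v is Lab1 then true else false.
pose i x := val (f x).
have iX x : i x \in X := valP (f x).
have iE x y : (i x == i y) = (x == y).
  by rewrite /i val_eqE (bij_eq fbij).
have adjE x y : adj x y = lca_adj e g (i x) (i y).
  rewrite fE /explained /lca_adj -val_eqE; congr (_ && _).
  by case: lca.
have [o [oP otr]] := leaves_orientation acyc gal g leafX r.
have [o' [oP' otr']] := leaves_orientation acyc gal (negb \o g) leafX r.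
rewrite (leaves_root gal) in oP otr oP' otr'.
apply: (@permutation_graph_orientations _ _ (relpre i o) (relpre i o')) => //.
  split=> [x y _ _|y x z _ _ _]; first by rewrite adjE oP.
  exact: otr.
split=> [x y _ _|y x z _ _ _]; last exact: otr'.
rewrite /= -oP' // adjE /lca_adj iE; case: eqP => //= _.
(* Negating [g] complements the adjacency only where the lca exists, since the default value [false]
   is not negated. *)
by have [v ->] := lca_exists acyc gal (i x) (i y).
Qed.
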